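(* Let $T$ be a tree of order $n\ge 2$, and let $P_n$ denote the path on $n$ vertices. Then $cfc(T)\ge cfc(P_n)=\lceil \log_2 n\rceil$.
   Context: For an edge-colored graph, a path is conflict-free if some color occurs on exactly one of its edges. An edge-coloring of a connected graph $G$ is a conflict-free connection coloring if every pair of distinct vertices is joined by a conflict-free path; $cfc(G)$ is the minimum number of colors in such a coloring. *)

(* Defs.v *)
From mathcomp Require Import boolp.
From mathcomp Require Import all_boot.

Set Implicit Arguments.
Unset Strict Implicit.
Unset Printing Implicit Defensive.

Record sgraph := SGraph {
  vertex :> finType;
  adj : rel vertex;
  adj_sym : symmetric adj;
  adj_irrefl : irreflexive adj
}.

Definition edges (G : sgraph) : {set {set G}} :=
  [set [set u.1; u.2] | u : G * G & adj u.1 u.2].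

Definition edge (G : sgraph) := {E : {set G} | E \in edges G}.

Definition connected (G : sgraph) : Prop :=
  forall x y : G, connect (@adj G) x y.

Definition acyclic (G : sgraph) : Prop :=
  forall s : seq G, ucycle (@adj G) s -> size s < 3.

Record is_tree (G : sgraph) : Prop := IsTree {
  tree_connected : connected G;
  tree_acyclic : acyclic G
}.

Definition is_path (G : sgraph) (x y : G) (p : seq G) : Prop :=
  [/\ path (@adj G) x p, last x p = y & uniq (x :: p)].

Definition path_edges (G : sgraph) (x : G) (p : seq G) : {set edge G} :=
  [set E | val E \in pairmap (fun u v : G => [set u; v]) x p].

Definition conflict_free (G : sgraph) (k : nat) (c : edge G -> 'I_k)
    (x : G) (p : seq G) : Prop :=
  exists a : 'I_k, #|[set E in path_edges x p | c E == a]| = 1.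

Definition cfc_coloring (G : sgraph) (k : nat) (c : edge G -> 'I_k) : Prop :=
  forall x y : G, x != y -> exists2 p, is_path x y p & conflict_free c x p.

(* The colors are drawn from a palette of size k, not all of which need be
   used; this does not affect the minimum. *)
Definition cfc_colorable (G : sgraph) (k : nat) : Prop :=
  exists c : edge G -> 'I_k, cfc_coloring c.

Lemma cfc_colorable_ex (G : sgraph) :
  connected G -> exists k, `[< cfc_colorable G k >].
Proof.
move=> conG; exists #|{: edge G}|; apply/asboolP.
exists enum_rank => x y neq_xy.
have /connectP[q pq yq] := conG x y.
case: (shortenP pq) yq => -[|z p] /= pp up _ yp.
  by rewrite yp eqxx in neq_xy.
exists (z :: p) => //.
have /andP[xz _] := pp.
have xzE : [set x; z] \in edges G by apply/imsetP; exists (x, z); rewrite ?inE.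
pose E0 : edge G := Sub [set x; z] xzE.
exists (enum_rank E0); apply/eqP/cards1P; exists E0; apply/setP => E.
rewrite !inE (inj_eq enum_rank_inj) andbC; case: (E =P E0) => [->|//].
by rewrite /= eqxx.
Qed.

(* The value does not depend on the proof conG, by minimality. *)
Definition cfc (G : sgraph) (conG : connected G) : nat :=
  ex_minn (cfc_colorable_ex conG).

Definition path_adj (n : nat) : rel 'I_n :=
  fun i j => (i.+1 == j) || (j.+1 == i).

Lemma path_adj_sym n : symmetric (@path_adj n).
Proof. by move=> i j; exact: orbC. Qed.

Lemma path_adj_irrefl n : irreflexive (@path_adj n).
Proof. by move=> i; rewrite /path_adj orbb gtn_eqF. Qed.

Definition path_graph (n : nat) : sgraph :=
  SGraph (@path_adj_sym n) (@path_adj_irrefl n).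

Lemma path_graph_connected n : connected (path_graph n).
Proof.
have up (m : nat) (i j : 'I_n) : i + m = j -> connect (@path_adj n) i j.
  elim: m j => [|m IHm] j.
    by rewrite addn0 => /val_inj ->; exact: connect0.
  rewrite addnS => ij.
  have lt_im : i + m < n by rewrite (leq_trans _ (ltn_ord j)) // -ij.
  apply: connect_trans (IHm (Ordinal lt_im) erefl) _.
  by apply: connect1; rewrite /path_adj /= ij eqxx.
move=> i j; case: (leqP i j) => [le_ij|/ltnW le_ji].
  by apply: (up (j - i)); rewrite subnKC.
by rewrite (sym_connect_sym (@path_adj_sym n)) (up (i - j)) // subnKC.
Qed.

Arguments path_graph_connected n : clear implicits.

(* Main.v *)
Require Import Defs.
From mathcomp Require Import all_boot zify.

Set Implicit Arguments.
Unset Strict Implicit.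
Unset Printing Implicit Defensive.

(** Lower bound: in a tree, assign to each vertex [v] the vector in [F_2^k] of
    the parities of the color multiplicities along the path from a fixed root
    to [v]. The vectors of [u] and [v] differ by the parity vector of the path
    from [u] to [v], which is nonzero when that path is conflict-free. So a
    coloring with [k] colors forces the [n] vectors to be distinct, and
    [n <= 2 ^ k].
    Upper bound: color the [i]-th edge of the path by the 2-adic valuation of
    [i]; the largest valuation in an interval of positive integers is attained
    only once. *)

(** * Simple paths and their edge sequences *)

Notation edge_seq := (pairmap (fun u v => [set u; v])).

Section SimplePaths.
Variable G : sgraph.
Implicit Types (x y : G) (p q : seq G).

Lemma edge_seq_sub x p (F : {set G}) :
  F \in edge_seq x p -> {subset F <= x :: p}.
Proof.
elim: p x => //= y p IHp x; rewrite inE => /orP[/eqP->|/IHp sFp] z.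
  by rewrite !inE => /orP[] ->; rewrite ?orbT.
by rewrite inE => /sFp ->; rewrite orbT.
Qed.

Lemma edge_seq_uniq x p : uniq (x :: p) -> uniq (edge_seq x p).
Proof.
elim: p x => //= y p IHp x /andP[xp /IHp->]; rewrite andbT.
by apply: contra xp => /edge_seq_sub; apply; rewrite set21.
Qed.

Lemma edge_seq_edges x p F : path (@adj G) x p -> F \in edge_seq x p ->
  F \in edges G.
Proof.
elim: p x => //= y p IHp x /andP[xy /IHp{}IHp]; rewrite inE.
by case/orP => [/eqP->|/IHp//]; apply/imsetP; exists (x, y); rewrite ?inE.
Qed.

Lemma edge_seq_rev x p :
  edge_seq (last x p) (rev (belast x p)) = rev (edge_seq x p).
Proof.
elim: p x => //= y p IHp x; rewrite !rev_cons -IHp -!cats1 pairmap_cat /=.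
congr (_ ++ [:: _]); rewrite setUC; congr (_ :|: [set _]).
by case: p {IHp} => //= z p; rewrite rev_cons last_rcons.
Qed.

Lemma is_path_rev x y p : is_path x y p -> is_path y x (rev (belast x p)).
Proof.
case=> pp <- up; split.
- by rewrite rev_path (eq_path (e' := @adj G)) // => u v; rewrite adj_sym.
- by case: p {pp up} => //= z p; rewrite rev_cons last_rcons.
- by rewrite -rev_rcons rev_uniq -lastI.
Qed.

Lemma conflict_free_rev k (c : edge G -> 'I_k) x p :
  conflict_free c x p -> conflict_free c (last x p) (rev (belast x p)).
Proof.
case=> a card1; exists a; rewrite -card1; apply: eq_card => E.
by rewrite !inE edge_seq_rev mem_rev.
Qed.

(** Counting along the edge sequence makes parities additive under concatenation. No edge is counted
    twice, since a simple path repeats no edge. *)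
Lemma card_color_path k (c : edge G -> 'I_k) a x p :
  path (@adj G) x p -> uniq (x :: p) ->
  #|[set E in path_edges x p | c E == a]| =
  count (mem [set val E | E in [set E | c E == a]]) (edge_seq x p).
Proof.
move=> pp /edge_seq_uniq up; rewrite -(card_imset _ val_inj) -size_filter.
rewrite -(card_uniqP (filter_uniq _ up)); apply: eq_card => F.
rewrite mem_filter; apply/imsetP/andP => [[E + ->]|[/imsetP[E + ->] Ep]].
  by rewrite !inE => /andP[Ep cE]; rewrite /= imset_f // inE.
by rewrite inE => cE; exists E; rewrite // !inE cE andbT.
Qed.

(* If two simple paths leave [x] by distinct edges, then going along one and
   back along the other joins these neighbors while avoiding [x]; adding [x]
   closes a cycle. *)
Lemma acyclic_path_unique x y p q : acyclic G ->
  is_path x y p -> is_path x y q -> p = q.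
Proof.
move=> acG; elim: p x q => [|z p IHp] x [|w q] //=.
- by case=> _ /= <- _ [_ /= xq /andP[/negP[]]]; rewrite -{1}xq mem_last.
- case=> _ /= yp /andP[/negP xNp _] [_ /= xy _]; case: xNp.
  by rewrite xy -yp mem_last.
case=> /= /andP[xz zp] yp /andP[xNp up] [/= /andP[xw wq] yq /andP[xNq uq]].
have [eq_zw|neq_zw] := eqVneq z w.
  by rewrite -eq_zw in wq yq uq *; rewrite (IHp z q).
case: (@is_path_rev w y q) => // yq' wq' _.
have zpq : path (@adj G) z (p ++ rev (belast w q)) by rewrite cat_path zp yp.
have lpq : last z (p ++ rev (belast w q)) = w by rewrite last_cat yp.
have xN : x \notin z :: p ++ rev (belast w q).
  rewrite -cat_cons mem_cat negb_or xNp mem_rev /=.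
  by apply: contra xNq => /mem_belast.
case: (shortenP zpq) lpq => s zs us sub ws.
have : size (x :: z :: s) < 3.
  apply: acG; rewrite /ucycle /= rcons_path xz zs ws adj_sym xw.
  rewrite -[(z \notin s) && _]/(uniq (z :: s)) us !andbT.
  apply: contra xN; rewrite !inE => /orP[->//|/sub->].
  by rewrite orbT.
by case: s ws {zs us sub} neq_zw => //= ->; rewrite eqxx.
Qed.

End SimplePaths.

(** * Lower bound for trees *)

(** Take the parity of the number of edges in [A] on the simple path from a root: of the root paths
    to two adjacent vertices, one extends the other by the edge between them. *)
Lemma tree_potential (G : sgraph) (A : {set {set G}}) : is_tree G ->
  exists f : G -> bool,
    forall u v, adj u v -> f u (+) f v = ([set u; v] \in A).
Proof.
case=> conG acG; have [r _|G0] := pickP (mem G); last first.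
  by exists xpredT => u; have := G0 u; rewrite inE.
have /fin_all_exists[P PP] v : exists p, is_path r v p.
  have /connectP[q pq vq] := conG r v.
  by case: (shortenP pq) vq => p pp up _ vp; exists p.
pose f v := odd (count (mem A) (edge_seq r (P v))).
have ext u v : adj u v -> v \notin r :: P u ->
    f u (+) f v = ([set u; v] \in A).
  move=> uv vNu; have [pu lu uu] := PP u.
  have Pv : P v = rcons (P u) v.
    apply: acyclic_path_unique (PP v) _ => //; split.
    - by rewrite rcons_path pu lu.
    - by rewrite last_rcons.
    - by rewrite -rcons_cons rcons_uniq vNu.
  rewrite /f Pv -cats1 pairmap_cat count_cat oddD addbA addbb /= lu.
  by rewrite addn0 oddb.
(* If [v] lies on the root path to [u], then by uniqueness the root path to [v] is the prefix ending
   at [v]. It misses [u], so [ext] applies with the two vertices exchanged. *)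
exists f => u v uv; have [vPu|] := boolP (v \in r :: P u); last exact: ext.
rewrite addbC setUC; apply: ext; first by rewrite adj_sym.
have [pu lu uu] := PP u.
case/splitPl: vPu (PP v) pu lu uu => p1 p2 vp1 PPv.
rewrite cat_path last_cat -cat_cons cat_uniq vp1 => /andP[pp1 _] lp2.
case/and3P=> up1 /hasPn dis _.
have -> : P v = p1 by apply: acyclic_path_unique PPv _.
apply: dis; rewrite -lp2; case: p2 lp2 => [/= eq_vu|z p2 _].
  by rewrite eq_vu adj_irrefl in uv.
by have := mem_last z p2.
Qed.

(** The sum telescopes modulo 2: inner vertices contribute twice. *)
Lemma potential_path (G : sgraph) (A : {set {set G}}) (f : G -> bool) x p :
  (forall u v, adj u v -> f u (+) f v = ([set u; v] \in A)) ->
  path (@adj G) x p ->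
  f x (+) f (last x p) = odd (count (mem A) (edge_seq x p)).
Proof.
move=> fA; elim: p x => [|y p IHp] x /=; first by rewrite addbb.
case/andP=> xy /IHp yp; rewrite oddD oddb -yp -fA //.
by rewrite addbA -(addbA (f x)) addbb addbF.
Qed.

Lemma tree_cfc_card (G : sgraph) k :
  is_tree G -> cfc_colorable G k -> #|G| <= 2 ^ k.
Proof.
move=> treeG [c cfc_c].
pose A a := [set val E | E in [set E : edge G | c E == a]].
have /fin_all_exists[f fA] a := tree_potential (A a) treeG.
have inj : injective (fun v : G => [ffun a => f a v]).
  move=> u v /ffunP eq_uv; apply/eqP/negPn/negP => /cfc_c[p [pp lp up] [a]].
  rewrite card_color_path // => cnt1.
  have := potential_path (fA a) pp; have := eq_uv a.
  by rewrite !ffunE lp cnt1 => ->; rewrite addbb.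
by have := leq_card _ inj; rewrite card_ffun card_bool card_ord.
Qed.

(** * The path graph is a tree *)

(** Both cyclic neighbors of the largest vertex [m] of a cycle equal [m - 1], so a cycle of length
    at least 3 would repeat a vertex. *)
Lemma path_graph_acyclic n : acyclic (path_graph n).
Proof.
move=> [|x0 s0] // /andP[]; set s := x0 :: s0 => cs us.
have [m ms max_m] : exists2 m, m \in s & {in s, forall i : 'I_n, i <= m}.
  have x0s : x0 \in s by rewrite mem_head.
  case: (@arg_maxnP _ x0 (mem s) (@nat_of_ord n) x0s) => m ms max_m.
  by exists m.
have [i t rot_s] := rot_to ms.
rewrite -(size_rot i s) rot_s; move: cs us; rewrite -(rot_cycle i) -(rot_uniq i).
have {}max_m : {in t, forall j : 'I_n, j <= m}.
  by move=> j jt; apply: max_m; rewrite -(mem_rot i) rot_s inE jt orbT.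
rewrite rot_s; case: t {rot_s} max_m => [|y [|z t]] // max_m.
rewrite /= rcons_path => /and4P[my _ _ lm] /and3P[_ + _].
have yE : y.+1 = m :> nat.
  by have := max_m y (mem_head _ _); move: my; rewrite /path_adj; lia.
have lE : (last z t).+1 = m :> nat.
  have lt : last z t \in y :: z :: t by rewrite inE mem_last orbT.
  by have := max_m _ lt; move: lm; rewrite /= /path_adj; lia.
have -> : y = last z t by apply/val_inj/succn_inj; rewrite yE lE.
by rewrite mem_last.
Qed.

Lemma path_graph_tree n : is_tree (path_graph n).
Proof. by split; [exact: path_graph_connected | exact: path_graph_acyclic]. Qed.

(** * Coloring the path by 2-adic valuations *)

(** The edge joining [i - 1] to [i] gets the number [i]: edges are numbered from 1, and
    consecutively along a subpath. A maximum avoids orienting the edge. *)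
Definition edge_top n (F : {set 'I_n}) : nat := \max_(i in F) i.

Lemma edge_top2 n (i j : 'I_n) : i <= j -> edge_top [set i; j] = j.
Proof.
move=> le_ij; have [<-|neq_ij] := eqVneq i j.
  by rewrite /edge_top setUid big_set1.
by rewrite /edge_top big_setU1 ?inE // big_set1; apply/maxn_idPr.
Qed.

Lemma edge_top_inj n :
  {in edges (path_graph n) &, injective (@edge_top n)}.
Proof.
have edgeE F : F \in edges (path_graph n) ->
    exists u v : 'I_n, u.+1 = v /\ F = [set u; v].
  case/imsetP=> [[u v]]; rewrite !inE /= /path_adj => /orP[]/eqP uv ->.
    by exists u, v.
  by exists v, u; rewrite setUC.
move=> _ _ /edgeE[u [v [uv ->]]] /edgeE[u' [v' [uv' ->]]].
rewrite !edge_top2 -?uv -?uv' // => -[/val_inj eq_u].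
by move: uv; rewrite eq_u uv' => /val_inj->.
Qed.

(** The bound on the vertices of [p] strengthens the induction: it keeps the newly prepended vertex
    from recurring. *)
Lemma path_graph_up n m (x y : 'I_n) : x + m = y ->
  exists2 p, @is_path (path_graph n) x y p &
    map (@edge_top n) (edge_seq x p) = iota x.+1 m /\
    {in p, forall z : 'I_n, x < z}.
Proof.
elim: m x => [|m IHm] x.
  by rewrite addn0 => /val_inj->; exists [::].
rewrite addnS -addSn => xy.
have lt_n : x.+1 < n by rewrite (leq_ltn_trans _ (ltn_ord y)) // -xy leq_addr.
have [p [pp lp up] [ep gtp]] := IHm (Ordinal lt_n) xy.
exists (Ordinal lt_n :: p); last split.
- split=> //; first by rewrite /= pp /path_adj eqxx.
  rewrite cons_uniq up andbT inE negb_or -val_eqE /= neq_ltn leqnn /=.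
  by apply/negP => /gtp /=; lia.
- by rewrite /= ep edge_top2 /=.
- by move=> z; rewrite inE => /orP[/eqP->|/gtp/ltnW].
Qed.

(* If [2 ^ a] is the largest power of 2 dividing a member of the interval, it
   divides only one member: one of two consecutive multiples of [2 ^ a] is a
   multiple of [2 ^ a.+1]. *)
Lemma max_logn2_unique x m : 0 < m ->
  exists2 i, i \in iota x.+1 m &
    {in iota x.+1 m, forall j, logn 2 j = logn 2 i -> j = i}.
Proof.
move=> m0.
have ex1 : exists a, has (fun j => 2 ^ a %| j) (iota x.+1 m).
  by exists 0; apply/hasP; exists x.+1; rewrite ?mem_iota ?dvd1n //; lia.
have bnd a : has (fun j => 2 ^ a %| j) (iota x.+1 m) -> a <= x + m.
  case/hasP=> j; rewrite mem_iota => jr /dvdn_leq le_aj.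
  have := ltn_expl a (ltnSn 1); have : 0 < j by lia.
  by move/le_aj; lia.
case: (ex_maxnP ex1 bnd) => a /hasP[i ir dvd_i] max_a.
have lognE j : j \in iota x.+1 m -> 2 ^ a %| j -> logn 2 j = a.
  move=> jr dvd_j; have j0 : 0 < j by move: jr; rewrite mem_iota; lia.
  apply/eqP; rewrite eqn_leq -pfactor_dvdn // dvd_j andbT.
  by apply: max_a; apply/hasP; exists j; rewrite ?pfactor_dvdnn.
have gap j j' : j \in iota x.+1 m -> j' \in iota x.+1 m ->
    2 ^ a %| j -> 2 ^ a %| j' -> j < j' -> False.
  move=> jr j'r /dvdnP[q jE] /dvdnP[q' j'E] lt_jj'.
  have e0 : 0 < 2 ^ a by rewrite expn_gt0.
  have lt_qq' : q < q' by rewrite -(ltn_pmul2r e0) -jE -j'E.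
  have [b [b_ge b_le b_even]] : exists b, [/\ q <= b, b <= q' & 2 %| b].
    (* This rounds [q] up to an even number, at most [q + 1] and hence at most [q']. *)
    exists (q + odd q); rewrite leq_addr dvdn2 oddD oddb addbb.
    by split=> //; case: (odd q); lia.
  suff : a.+1 <= a by rewrite ltnn.
  apply: max_a; apply/hasP; exists (b * 2 ^ a).
    have : j <= b * 2 ^ a by rewrite jE leq_mul2r b_ge orbT.
    have : b * 2 ^ a <= j' by rewrite j'E leq_mul2r b_le orbT.
    by move: jr j'r; rewrite !mem_iota; lia.
  by rewrite expnS dvdn_mul.
exists i => // j jr; rewrite (lognE i ir dvd_i) => logj.
have dvd_j : 2 ^ a %| j by rewrite -logj pfactor_dvdnn.
have [lt_ji|lt_ij|//] := ltngtP j i; first by case: (gap j i).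
by case: (gap i j).
Qed.

Lemma path_graph_colorable n k : 0 < k -> n <= 2 ^ k ->
  cfc_colorable (path_graph n) k.
Proof.
move=> k0 le_nk.
have col_lt (F : {set 'I_n}) : logn 2 (edge_top F) < k.
  (* [F] is an arbitrary vertex set, so its top may be 0; there [logn 2 0 = 0], and [k0]
     concludes. *)
  have [->|top0] := posnP (edge_top F); first by rewrite logn0.
  rewrite -(ltn_exp2l _ _ (ltnSn 1)); apply: leq_trans le_nk.
  apply: (@leq_ltn_trans (edge_top F)).
    by rewrite dvdn_leq // pfactor_dvdnn.
  have n0 : 0 < n.
    by case: n F top0 => [|//] F; rewrite /edge_top big1 // => -[].
  suff : edge_top F <= n.-1 by lia.
  by apply/bigmax_leqP => i _; rewrite -ltnS prednK.
pose c (E : edge (path_graph n)) := Ordinal (col_lt (val E)).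
have up (x y : 'I_n) : x < y ->
    exists2 p, @is_path (path_graph n) x y p & conflict_free c x p.
  move=> lt_xy; have [p xyp [topp _]] := path_graph_up (subnKC (ltnW lt_xy)).
  exists p => //.
  have [|i + uniq_i] := @max_logn2_unique x (y - x); first by rewrite subn_gt0.
  rewrite -topp => /mapP[F Fp iF]; have [pp _ _] := xyp.
  pose E0 : edge (path_graph n) := Sub F (edge_seq_edges pp Fp).
  exists (c E0); apply/eqP/cards1P; exists E0; apply/setP => E; rewrite !inE.
  apply/andP/eqP => [[Ep /eqP[eq_c]]|->]; last by split.
  apply/val_inj/edge_top_inj; [exact: valP | exact: valP |].
  rewrite /= -iF; apply: uniq_i; last by rewrite iF.
  by rewrite -topp map_f.
exists c => x y; rewrite -val_eqE neq_ltn => /orP[/up//|/up[p yxp cf]].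
exists (rev (belast y p)); first exact: is_path_rev.
by case: (yxp) => _ <- _; exact: conflict_free_rev.
Qed.

(** * The two bounds combined *)

Lemma tree_cfc_ge (G : sgraph) (conG : connected G) :
  is_tree G -> up_log 2 #|G| <= cfc conG.
Proof.
move=> treeG; rewrite /cfc; case: ex_minnP => k /boolp.asboolP colk _.
by apply: up_log_min => //; apply: tree_cfc_card.
Qed.

Theorem theorem2p5 (n : nat) (T : sgraph) (hn : 2 <= n) (hT : is_tree T)
    (oT : #|T| = n) :
  cfc (tree_connected hT) >= cfc (path_graph_connected n) /\
  cfc (path_graph_connected n) = up_log 2 n.
Proof.
have cfcP : cfc (path_graph_connected n) = up_log 2 n.
  apply/eqP; rewrite eqn_leq; apply/andP; split; last first.
    by rewrite -{1}(card_ord n); exact: tree_cfc_ge (path_graph_tree n).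
  rewrite /cfc; case: ex_minnP => k _; apply; apply/boolp.asboolP.
  (* [hn] makes [up_log 2 n] positive, so the palette is nonempty. *)
  by apply: path_graph_colorable; rewrite ?up_log_gt0 ?up_logP.
by split; rewrite // cfcP -oT; exact: tree_cfc_ge.
Qed.
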